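(* Let $1\le i<j<k\le n$ and suppose $\{\alpha,\beta\}=\{e_i-e_j,\;e_j-e_k\}$ (in either order). Then, as operators on $\mathbb{Z}[x_1,\dots,x_n]$, $$\partial_{\alpha+\beta}=\tau_\alpha\partial_\beta+\partial_\alpha+\beta\,\partial_{\alpha+\beta}\partial_\alpha,$$ $$\partial_{\alpha+\beta}=\tau_\beta\tau_\alpha\partial_\beta+\tau_\beta\partial_\alpha-\beta\,\partial_{\alpha+\beta}\partial_\beta.$$
   Context: For a positive root $\alpha=e_a-e_b$ ($1\le a<b\le n$): $\tau_\alpha=(a,b)$ is the reflection, acting on $\mathbb{Z}[x_1,\dots,x_n]$ by swapping $x_a$ and $x_b$; $\alpha$ itself, viewed as an operator, is multiplication by $x_b-x_a$; and $\partial_\alpha f=\dfrac{f-\tau_\alpha f}{x_a-x_b}$ is the long-range divided difference. Products of operators are compositions (rightmost applied first). Note $\alpha+\beta=e_i-e_k$. *)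

(* Defs.v *)
From HB Require Import structures.
From mathcomp Require Import all_boot all_order all_fingroup all_algebra.
From mathcomp.multinomials Require Import mpoly.

Set Implicit Arguments.
Unset Strict Implicit.
Unset Printing Implicit Defensive.

Import GRing.Theory.
Local Open Scope ring_scope.

(* Coordinates are indexed by 'I_n = {0, ..., n-1}; the index a of 'I_n stands
   for the 1-based index a + 1. *)

(* basisv a - basisv b is the vector e_a - e_b of the root lattice in Z^n. *)
Definition basisv (n : nat) (a : 'I_n) : 'rV[int]_n := delta_mx 0 a.

Record posroot (n : nat) := PosRoot {
  ra : 'I_n;
  rb : 'I_n;
  ra_lt_rb : (ra < rb)%N }.

Definition rootv (n : nat) (r : posroot n) : 'rV[int]_n :=
  basisv (ra r) - basisv (rb r).

Definition tau (n : nat) (r : posroot n) (f : {mpoly int[n]}) :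
  {mpoly int[n]} := msym (tperm (ra r) (rb r)) f.

(* The root e_a - e_b viewed as an operator is multiplication by x_b - x_a;
   the sign is opposite to that of the denominator x_a - x_b in [dd]. *)
Definition mulroot (n : nat) (r : posroot n) (f : {mpoly int[n]}) :
  {mpoly int[n]} := ('X_(rb r) - 'X_(ra r)) * f.

Lemma dd_exists (n : nat) (r : posroot n) (f : {mpoly int[n]}) :
  exists g, ('X_(ra r) - 'X_(rb r)) * g == f - tau r f.
Proof.
pose D : {mpoly int[n]} := 'X_(ra r) - 'X_(rb r).
pose Q (h : {mpoly int[n]}) := exists g, D * g == h - tau r h.
have QD h1 h2 : Q h1 -> Q h2 -> Q (h1 + h2).
  move=> [g1 /eqP e1] [g2 /eqP e2]; exists (g1 + g2).
  by rewrite mulrDr e1 e2 /tau msymD opprD addrACA.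
have QM h1 h2 : Q h1 -> Q h2 -> Q (h1 * h2).
  move=> [g1 /eqP e1] [g2 /eqP e2]; exists (g1 * h2 + tau r h1 * g2).
  rewrite mulrDr mulrA e1 mulrCA e2 /tau msymM mulrBl mulrBr.
  by rewrite addrA subrK.
have Q1 : Q 1 by exists 0; rewrite mulr0 /tau msym1 subrr.
have QX i : Q 'X_i.
  have -> : Q 'X_i = exists g, D * g == 'X_i - 'X_(tperm (ra r) (rb r) i).
    by rewrite /Q /tau /msym mmapX mmap1U.
  case: tpermP => [->|->|_ _].
  - by exists 1; rewrite mulr1.
  - by exists (- 1); rewrite mulrN1 opprB.
  - by exists 0; rewrite mulr0 subrr.
elim/mpolyind: f => [|c m p _ _ Qp].
  by exists 0; rewrite mulr0 /tau msym0 subrr.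
apply: QD Qp; suff [g /eqP e] : Q 'X_[m].
  by exists (c *: g); rewrite -scalerAr e /tau msymZ scalerBr.
rewrite mpolyXE_id; apply: (big_ind Q) => // i _.
elim: (m i) => [|k IH]; first by rewrite expr0.
by rewrite exprS; apply: QM.
Qed.

(* The quotient (f - tau f) / (x_a - x_b), taken inside Z[x_1, ..., x_n]:
   [ddE] and [dd_uniq] say that it is the only polynomial whose product with
   x_a - x_b is f - tau f. *)
Definition dd (n : nat) (r : posroot n) (f : {mpoly int[n]}) :
  {mpoly int[n]} := xchoose (dd_exists r f).

Lemma ddE (n : nat) (r : posroot n) (f : {mpoly int[n]}) :
  ('X_(ra r) - 'X_(rb r)) * dd r f = f - tau r f.
Proof. exact/eqP/(xchooseP (dd_exists r f)). Qed.

Lemma rootX_neq0 (n : nat) (r : posroot n) :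
  'X_(ra r) - 'X_(rb r) != 0 :> {mpoly int[n]}.
Proof.
rewrite subr_eq0; apply/eqP => /(congr1 (mcoeff U_(ra r)%MM)).
rewrite !mcoeffX eqxx; case: eqP => // /mnmP /(_ (rb r)).
rewrite !mnm1E eqxx => e; have := ra_lt_rb r.
by move: e; case: eqP => // ->; rewrite ltnn.
Qed.

Lemma dd_uniq (n : nat) (r : posroot n) (f g : {mpoly int[n]}) :
  ('X_(ra r) - 'X_(rb r)) * g = f - tau r f -> g = dd r f.
Proof. by rewrite -ddE => /(mulfI (rootX_neq0 r)). Qed.

Lemma rootv_inj (n : nat) (r s : posroot n) :
  rootv r = rootv s -> ra r = ra s /\ rb r = rb s.
Proof.
case: r s => [a b ab] [c d cd] /rowP e /=.
have ne (u v : 'I_n) : (u < v)%N -> (u == v) = false.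
  by move=> uv; apply/eqP => E; rewrite E ltnn in uv.
move: (e a) (e b); rewrite !mxE !eqxx /= (ne _ _ ab) (eq_sym b) (ne _ _ ab).
case: (a =P c) => [->|_]; case: (b =P d) => [->|_] //=;
  by do 2 case: eqP.
Qed.

Lemma rootvD (n : nat) (i j k : 'I_n) (hij : (i < j)%N) (hjk : (j < k)%N)
    (hik : (i < k)%N) :
  rootv (PosRoot hij) + rootv (PosRoot hjk) = rootv (PosRoot hik).
Proof. by rewrite /rootv /= addrA subrK. Qed.

(* Main.v *)
(* Write x, y, z for the variables of which alpha swaps the first two and beta
   the last two.  Since tau_(alpha+beta) equals both tau_alpha tau_beta tau_alpha
   and tau_beta tau_alpha tau_beta, clearing the denominators x - z and x - y in
   both formulas leaves linear identities between the six translates of f.  The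
   second ordering of the roots reverses the signs of x - y, y - z and x - z, so
   the argument is run for any operators satisfying the three defining equations
   and then applied to the opposites of the divided differences. *)

Require Import Defs.
From mathcomp Require Import all_boot all_order all_fingroup all_algebra.
From mathcomp.multinomials Require Import mpoly.
From mathcomp Require Import ring.
Import GRing.Theory.
Local Open Scope ring_scope.

(** [S] sends y - z to x - z, and [U] sends x - y to z - y, so the transported quotients have known
    products. After multiplication by x - z, the coefficients x - z and z - y of [dS f] add up to x
    - y. *)
Lemma braid_dd1 (P : idomainType) (x y z : P) (S T U : {rmorphism P -> P})
    (dS dT dU : P -> P) :
  S y = x -> S z = z -> U x = z -> U y = y -> x != z ->
  (forall f, (x - y) * dS f = f - S f) ->
  (forall f, (y - z) * dT f = f - T f) ->
  (forall f, (x - z) * dU f = f - U f) ->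
  (forall f, U (S f) = S (T f)) ->
  forall f, dU f = S (dT f) + dS f + (z - y) * dU (dS f).
Proof.
move=> Sy Sz Ux Uy xz dSE dTE dUE US f.
apply: (@mulfI _ (x - z)); first by rewrite subr_eq0.
have e1 := congr1 S (dTE f); have e2 := congr1 U (dSE f).
have e3 := dUE (dS f); have e4 := dSE f.
rewrite !(rmorphM, rmorphB) /= Sy Sz in e1.
rewrite !(rmorphM, rmorphB) /= Ux Uy US in e2.
have e5 := dUE f.
apply/eqP; rewrite -subr_eq0; apply/eqP.
(* Each parenthesis is one of the equations [e1] to [e5] with its right side moved left, hence zero;
   [ring] treats the operator values as atoms. *)
transitivity (((x - z) * dU f - (f - U f))
  - ((x - z) * S (dT f) - (S f - S (T f)))
  - (z - y) * ((x - z) * dU (dS f) - (dS f - U (dS f)))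
  + ((z - y) * U (dS f) - (U f - S (T f)))
  - ((x - y) * dS f - (f - S f))); first by ring.
by rewrite e1 e2 e3 e4 e5 !subrr !mulr0 !(addr0, subr0).
Qed.

(** Here both denominators are needed: [T] after [S] turns y - z into x - y, while [T] turns x - y
    into x - z. Also [U] turns y - z into y - x. *)
Lemma braid_dd2 (P : idomainType) (x y z : P) (S T U : {rmorphism P -> P})
    (dS dT dU : P -> P) :
  S y = x -> S z = z -> T x = x -> T y = z -> T z = y -> U y = y -> U z = x ->
  x != y -> x != z ->
  (forall f, (x - y) * dS f = f - S f) ->
  (forall f, (y - z) * dT f = f - T f) ->
  (forall f, (x - z) * dU f = f - U f) ->
  (forall f, U f = T (S (T f))) -> (forall f, U (T f) = T (S f)) ->
  forall f, dU f = T (S (dT f)) + T (dS f) - (z - y) * dU (dT f).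
Proof.
move=> Sy Sz Tx Ty Tz Uy Uz xy xz dSE dTE dUE UE UT f.
apply: (@mulfI _ ((x - y) * (x - z))); first by rewrite mulf_neq0 ?subr_eq0.
have e1 := congr1 T (congr1 S (dTE f)); have e2 := congr1 T (dSE f).
have e3 := dUE (dT f); have e4 := congr1 U (dTE f); have e5 := dTE f.
have e6 := dUE f.
rewrite !(rmorphM, rmorphB) /= Sy Sz Tx Tz -UE in e1.
rewrite !(rmorphM, rmorphB) /= Tx Ty in e2.
rewrite !(rmorphM, rmorphB) /= Uy Uz UT in e4.
apply/eqP; rewrite -subr_eq0; apply/eqP.
transitivity ((x - y) * ((x - z) * dU f - (f - U f))
  - (x - z) * ((x - y) * T (S (dT f)) - (T (S f) - U f))
  - (x - y) * ((x - z) * T (dS f) - (T f - T (S f)))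
  + (x - y) * (z - y) * ((x - z) * dU (dT f) - (dT f - U (dT f)))
  - (x - y) * ((y - z) * dT f - (f - T f))
  + (z - y) * ((y - x) * U (dT f) - (U f - T (S f)))); first by ring.
by rewrite e1 e2 e3 e4 e5 e6 !subrr !mulr0 !(addr0, subr0).
Qed.

Lemma msym_tpermX (n : nat) (a b c : 'I_n) :
  msym (tperm a b) 'X_c = 'X_(tperm a b c) :> {mpoly int[n]}.
Proof. by rewrite /msym mmapX mmap1U. Qed.

Lemma mpolyX_neq (n : nat) (a b : 'I_n) :
  a != b -> 'X_a != 'X_b :> {mpoly int[n]}.
Proof.
apply: contraNneq => /(congr1 (mcoeff U_(a)%MM)).
rewrite !mcoeffX eqxx; case: eqP => // /mnmP /(_ a).
by rewrite !mnm1E eqxx [b == a]eq_sym; case: (a == b).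
Qed.

(** Conjugation by [tperm b c] relabels b as c and fixes a. *)
Lemma tperm_braid (T : finType) (a b c : T) : a != b -> b != c -> a != c ->
  (tperm b c * tperm a b * tperm b c = tperm a c)%g.
Proof.
move=> ab bc ac; have /= := tpermJ a b (tperm b c).
by rewrite tpermL tpermD 1?eq_sym // conjgE tpermV mulgA.
Qed.

(** The indices are only asked to be distinct, so that both (i, j, k) and (k, j, i) can be
    substituted for (a, b, c). *)
Lemma dd_braid (n : nat) (a b c : 'I_n)
    (dS dT dU : {mpoly int[n]} -> {mpoly int[n]}) :
  a != b -> b != c -> a != c ->
  (forall f, ('X_a - 'X_b) * dS f = f - msym (tperm a b) f) ->
  (forall f, ('X_b - 'X_c) * dT f = f - msym (tperm b c) f) ->
  (forall f, ('X_a - 'X_c) * dU f = f - msym (tperm a c) f) ->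
  forall f,
  dU f = msym (tperm a b) (dT f) + dS f + ('X_c - 'X_b) * dU (dS f)
  /\ dU f = msym (tperm b c) (msym (tperm a b) (dT f))
           + msym (tperm b c) (dS f) - ('X_c - 'X_b) * dU (dT f).
Proof.
move=> ab bc ac dSE dTE dUE f.
have [ba cb ca] : [/\ b != a, c != b & c != a] by rewrite !(eq_sym c) (eq_sym b).
have U1 : (tperm b c * tperm a b * tperm b c = tperm a c)%g by exact: tperm_braid.
have U2 : (tperm a b * tperm b c * tperm a b = tperm a c)%g.
  (* The other braid word is the same lemma with a and c exchanged. *)
  by rewrite [tperm a b]tpermC [tperm b c]tpermC [RHS]tpermC tperm_braid.
have tpermX (u v w : 'I_n) : u != w -> v != w ->
    [/\ msym (tperm u v) 'X_u = 'X_v :> {mpoly int[n]},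
        msym (tperm u v) 'X_v = 'X_u :> {mpoly int[n]}
      & msym (tperm u v) 'X_w = 'X_w :> {mpoly int[n]}].
  by move=> uw vw; rewrite !msym_tpermX tpermL tpermR tpermD.
have [Sa Sb Sc] := tpermX a b c ac bc.
have [Tb Tc Ta] := tpermX b c a ba ca.
have [Ua Uc Ub] := tpermX a c b ab cb.
(* A permutation product applies its left factor first, so composites of [msym] become products in
   reverse order; the leading transposition then cancels. *)
have US (g : {mpoly int[n]}) :
    msym (tperm a c) (msym (tperm a b) g)
    = msym (tperm a b) (msym (tperm b c) g).
  by rewrite -!msymMm -U2 !mulgA tperm2 mul1g.
have UT (g : {mpoly int[n]}) :
    msym (tperm a c) (msym (tperm b c) g)
    = msym (tperm b c) (msym (tperm a b) g).
  by rewrite -!msymMm -U1 !mulgA tperm2 mul1g.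
have UE (g : {mpoly int[n]}) : msym (tperm a c) g =
    msym (tperm b c) (msym (tperm a b) (msym (tperm b c) g)).
  by rewrite -!msymMm mulgA U1.
split.
- exact: (@braid_dd1 {mpoly int[n]} 'X_a 'X_b 'X_c (msym (tperm a b))
    (msym (tperm b c)) (msym (tperm a c)) dS dT dU Sb Sc Ua Ub
    (mpolyX_neq _ _ _ ac) dSE dTE dUE US f).
- exact: (@braid_dd2 {mpoly int[n]} 'X_a 'X_b 'X_c (msym (tperm a b))
    (msym (tperm b c)) (msym (tperm a c)) dS dT dU Sb Sc Ta Tb Tc Ub Uc
    (mpolyX_neq _ _ _ ab) (mpolyX_neq _ _ _ ac) dSE dTE dUE UE UT f).
Qed.

Theorem theorem4p1 (n : nat) (i j k : 'I_n) (hij : (i < j)%N) (hjk : (j < k)%N)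
    (alpha beta alphabeta : posroot n)
    (h : (rootv alpha = basisv i - basisv j /\ rootv beta = basisv j - basisv k)
         \/
         (rootv alpha = basisv j - basisv k /\ rootv beta = basisv i - basisv j))
    (hsum : rootv alphabeta = rootv alpha + rootv beta) :
  (dd alphabeta =1
     (tau alpha \o dd beta) \+ dd alpha
       \+ (mulroot beta \o dd alphabeta \o dd alpha))
  /\
  (dd alphabeta =1
     (tau beta \o tau alpha \o dd beta) \+ (tau beta \o dd alpha)
       \- (mulroot beta \o dd alphabeta \o dd beta)).
Proof.
have hik := ltn_trans hij hjk.
have [ij jk ik] : [/\ i != j, j != k & i != k].
  by rewrite !neq_ltn hij hjk hik.
have [ai bk] : ra alphabeta = i /\ rb alphabeta = k.
  apply: (@rootv_inj _ _ (PosRoot hik)); rewrite hsum -(rootvD hij hjk).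
  by case: h => -[-> ->] //; rewrite addrC.
have dUE f : ('X_i - 'X_k) * dd alphabeta f = f - msym (tperm i k) f.
  by rewrite -ai -bk ddE.
case: h => -[hA hB].
- have /= [ai' bj] := @rootv_inj _ alpha (PosRoot hij) hA.
  have /= [aj bk'] := @rootv_inj _ beta (PosRoot hjk) hB.
  have dSE f : ('X_i - 'X_j) * dd alpha f = f - msym (tperm i j) f.
    by rewrite -ai' -bj ddE.
  have dTE f : ('X_j - 'X_k) * dd beta f = f - msym (tperm j k) f.
    by rewrite -aj -bk' ddE.
  have H := @dd_braid n _ _ _ _ _ _ ij jk ik dSE dTE dUE.
  by split=> f /=; rewrite /mulroot /tau ai' bj aj bk'; case: (H f).
- have /= [aj bk'] := @rootv_inj _ alpha (PosRoot hjk) hA.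
  have /= [ai' bj] := @rootv_inj _ beta (PosRoot hij) hB.
  (* Second ordering: (a, b, c) = (k, j, i), each divided difference being negated to match its
     reversed denominator. *)
  have dSE f : ('X_k - 'X_j) * - dd alpha f = f - msym (tperm k j) f.
    by rewrite mulrN -mulNr opprB tpermC -aj -bk' ddE.
  have dTE f : ('X_j - 'X_i) * - dd beta f = f - msym (tperm j i) f.
    by rewrite mulrN -mulNr opprB tpermC -ai' -bj ddE.
  have dUE' f : ('X_k - 'X_i) * - dd alphabeta f = f - msym (tperm k i) f.
    by rewrite mulrN -mulNr opprB tpermC dUE.
  (* By this oddness the two signs in the composite term cancel. Negating the whole identity then
     restores the other terms and turns the factor x_i - x_j into x_j - x_i, the multiplier of
     [beta]. *)
  have ddN f : dd alphabeta (- f) = - dd alphabeta f.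
    by apply/esym/dd_uniq; rewrite mulrN ddE /tau msymN opprB opprK addrC.
  rewrite eq_sym in ij; rewrite eq_sym in jk; rewrite eq_sym in ik.
  have H := @dd_braid n _ _ _ _ _ _ jk ij ik dSE dTE dUE'.
  split=> f /=; rewrite /mulroot /tau aj bk' ai' bj [tperm j k]tpermC
    ?[tperm i j]tpermC;
    have [e1 e2] := H f; apply: oppr_inj.
    by rewrite e1 msymN ddN opprK !opprD -mulNr opprB.
  by rewrite e2 !msymN ddN opprK; ring.
Qed.
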